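(* Let $\mathcal{S}\subseteq\mathbb{R}^M$ be a convex set described by constraints as $$\mathcal{S}=\{\boldsymbol{x}\in\mathbb{R}^M:\ \mathcal{Q}_q(\boldsymbol{x})\le 0,\ q=1,\dots,Q;\ \ \mathcal{R}_r(\boldsymbol{x})=0,\ r=1,\dots,R\},$$ where $\mathcal{Q}_q,\mathcal{R}_r:\mathbb{R}^M\to\mathbb{R}$ are continuously differentiable. Let $G, A_n, B_n$ ($n=1,\dots,N$) be real-valued continuously differentiable functions on an open set containing $\mathcal{S}$ such that, on $\mathcal{S}$, $A_n$ is convex with $A_n(\boldsymbol{x})\ge 0$, and $B_n$ is concave with $B_n(\boldsymbol{x})>0$. Consider the fractional program of minimizing $$H(\boldsymbol{x}) := G(\boldsymbol{x})+\sum_{n=1}^N \frac{A_n(\boldsymbol{x})}{B_n(\boldsymbol{x})}\quad\text{subject to } \boldsymbol{x}\in\mathcal{S},$$ and define, for $\boldsymbol{x}\in\mathcal{S}$ and $\boldsymbol{y}=[y_1,\dots,y_N]\in(0,\infty)^N$, $$W(\boldsymbol{x},\boldsymbol{y}) := G(\boldsymbol{x})+\sum_{n=1}^N\Big([A_n(\boldsymbol{x})]^2y_n+\frac{1}{4[B_n(\boldsymbol{x})]^2y_n}\Big).$$ If the alternating optimization process for minimizing $W$ over $\mathcal{S}\times(0,\infty)^N$ converges to $(\boldsymbol{x}^*,\boldsymbol{y}^* )$, then $\boldsymbol{x}^*$ is a stationary point of the problem of minimizing $H(\boldsymbol{x})$ subject to $\boldsymbol{x}\in\mathcal{S}$; that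 is, $\boldsymbol{x}^*$ satisfies the KKT conditions of this problem: there exist multipliers $\alpha_1,\dots,\alpha_Q$ and $\beta_1,\dots,\beta_R$ such that (stationarity) $\frac{\partial}{\partial x_m}\big(H(\boldsymbol{x})+\sum_{q=1}^Q\alpha_q\mathcal{Q}_q(\boldsymbol{x})+\sum_{r=1}^R\beta_r\mathcal{R}_r(\boldsymbol{x})\big)\big|_{\boldsymbol{x}=\boldsymbol{x}^*}=0$ for $m=1,\dots,M$; (primal feasibility) $\mathcal{Q}_q(\boldsymbol{x}^* )\le 0$ for $q=1,\dots,Q$ and $\mathcal{R}_r(\boldsymbol{x}^* )=0$ for $r=1,\dots,R$; (dual feasibility) $\alpha_q\ge 0$ for $q=1,\dots,Q$; (complementary slackness) $\alpha_q\mathcal{Q}_q(\boldsymbol{x}^* )=0$ for $q=1,\dots,Q$.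
   Context: Alternating optimization process: start from some $\boldsymbol{x}^{(0)}\in\mathcal{S}$. For $i=1,2,\dots$: (1) $\boldsymbol{y}^{(i)}\in(0,\infty)^N$ is a minimizer of $\boldsymbol{y}\mapsto W(\boldsymbol{x}^{(i-1)},\boldsymbol{y})$ over $(0,\infty)^N$, i.e. $y_n^{(i)}=\frac{1}{2A_n(\boldsymbol{x}^{(i-1)})B_n(\boldsymbol{x}^{(i-1)})}$; (2) $\boldsymbol{x}^{(i)}\in\mathcal{S}$ is a minimizer of $\boldsymbol{x}\mapsto W(\boldsymbol{x},\boldsymbol{y}^{(i)})$ over $\mathcal{S}$. The process is taken to be well defined (the minimizers exist at every step). It converges to $(\boldsymbol{x}^*,\boldsymbol{y}^* )\in\mathcal{S}\times(0,\infty)^N$ if $\boldsymbol{x}^{(i)}\to\boldsymbol{x}^*$ and $\boldsymbol{y}^{(i)}\to\boldsymbol{y}^*$.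
   Formalization: Adds Abadie's constraint qualification at x* (the tangent cone of S equals the linearized cone of the active constraints); without one the claim fails, e.g. Q_1(x)=x^2, G(x)=x, A_1=B_1=1, where S={0} and no multiplier exists. *)

(* Defs.v *)
From HB Require Import structures.
From mathcomp Require Import all_boot all_order all_algebra.
From mathcomp Require Import all_classical all_reals all_analysis.

Set Implicit Arguments.
Unset Strict Implicit.
Unset Printing Implicit Defensive.

Import Order.TTheory GRing.Theory Num.Theory.
Import numFieldNormedType.Exports.

Local Open Scope classical_set_scope.
Local Open Scope ring_scope.

Definition basis_vec (R : realType) (M : nat) (m : 'I_M) : 'rV[R]_M :=
  delta_mx 0 m.

(* [f] is a total function, but nothing is required of it outside [U]. *)
Definition C1_on (R : realType) (M : nat) (U : set 'rV[R]_M)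
    (f : 'rV[R]_M -> R) : Prop :=
  open U /\
  forall x, U x ->
    differentiable f x /\
    forall m : 'I_M, {for x, continuous ('D_(basis_vec R m) f)}.

Definition concave_function (R : realType) (M : nat) (D : set 'rV[R]_M)
    (f : 'rV[R]_M -> R) : Prop :=
  convex_function D (fun x => - f x).

Definition feasible_set (R : realType) (M nQ nR : nat)
    (Qc : 'I_nQ -> 'rV[R]_M -> R) (Rc : 'I_nR -> 'rV[R]_M -> R) :
    set 'rV[R]_M :=
  [set x | (forall q, Qc q x <= 0) /\ (forall r, Rc r x = 0)].

Definition positive_orthant (R : realType) (N : nat) : set 'rV[R]_N :=
  [set y | forall n, 0 < y 0 n].

Definition Hobj (R : realType) (M N : nat) (G : 'rV[R]_M -> R)
    (A B : 'I_N -> 'rV[R]_M -> R) (x : 'rV[R]_M) : R :=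
  G x + \sum_(n < N) A n x / B n x.

Definition Wobj (R : realType) (M N : nat) (G : 'rV[R]_M -> R)
    (A B : 'I_N -> 'rV[R]_M -> R) (x : 'rV[R]_M) (y : 'rV[R]_N) : R :=
  G x + \sum_(n < N) ((A n x) ^+ 2 * y 0 n
                      + 1 / (4 * (B n x) ^+ 2 * y 0 n)).

Definition is_minimizer (R : realType) (T : Type) (f : T -> R) (D : set T)
    (z : T) : Prop :=
  D z /\ forall z', D z' -> f z <= f z'.

(* [y 0] plays no role: the y-iterates are y 1, y 2, ... *)
Definition alternating_process (R : realType) (M N : nat)
    (W : 'rV[R]_M -> 'rV[R]_N -> R) (S : set 'rV[R]_M) (Y : set 'rV[R]_N)
    (x : nat -> 'rV[R]_M) (y : nat -> 'rV[R]_N) : Prop :=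
  S (x 0%N) /\
  forall i : nat,
    is_minimizer (fun v => W (x i) v) Y (y i.+1) /\
    is_minimizer (fun u => W u (y i.+1)) S (x i.+1).

(* Bouligand (contingent) cone. *)
Definition tangent_cone (R : realType) (M : nat) (S : set 'rV[R]_M)
    (x : 'rV[R]_M) : set 'rV[R]_M :=
  [set d | exists (z : nat -> 'rV[R]_M) (t : nat -> R),
    [/\ forall k, S (z k), forall k, 0 < t k, z @ \oo --> x,
        t @ \oo --> (0 : R) &
        (fun k => (t k)^-1 *: (z k - x)) @ \oo --> d]].

Definition linearized_cone (R : realType) (M nQ nR : nat)
    (Qc : 'I_nQ -> 'rV[R]_M -> R) (Rc : 'I_nR -> 'rV[R]_M -> R)
    (x : 'rV[R]_M) : set 'rV[R]_M :=
  [set d | (forall q, Qc q x = 0 -> 'D_d (Qc q) x <= 0) /\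
           (forall r, 'D_d (Rc r) x = 0)].

(* Abadie's constraint qualification. Some qualification is needed for
   minimality to imply the KKT conditions: with the single constraint
   x^2 <= 0 on the line, the minimizer 0 of the objective x has no KKT
   multiplier. When the feasible set is convex, this one is equivalent to
   Guignard's, the weakest possible, and it is implied by Slater's condition
   for convex constraints, by affine constraints, by LICQ and by MFCQ. *)
Definition abadie_cq (R : realType) (M nQ nR : nat)
    (Qc : 'I_nQ -> 'rV[R]_M -> R) (Rc : 'I_nR -> 'rV[R]_M -> R)
    (x : 'rV[R]_M) : Prop :=
  tangent_cone (feasible_set Qc Rc) x = linearized_cone Qc Rc x.

(* [is_derive] also asserts that the partial derivative exists, whereas
   ['D_v f x = 0] alone could hold through the default value of [lim]. *)
Definition kkt_point (R : realType) (M nQ nR : nat) (f : 'rV[R]_M -> R)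
    (Qc : 'I_nQ -> 'rV[R]_M -> R) (Rc : 'I_nR -> 'rV[R]_M -> R)
    (x : 'rV[R]_M) : Prop :=
  exists (alpha : 'I_nQ -> R) (beta : 'I_nR -> R),
    [/\ forall m : 'I_M,
          is_derive x (basis_vec R m)
            (fun z => f z + \sum_(q < nQ) alpha q * Qc q z
                          + \sum_(r < nR) beta r * Rc r z) 0,
        (forall q, Qc q x <= 0) /\ (forall r, Rc r x = 0),
        forall q, 0 <= alpha q &
        forall q, alpha q * Qc q x = 0].

(* Main.v *)
(** In the limit, [xs] minimizes [W(., ys)] over the feasible set, while the
    explicit solution [y_n = 1 / (2 A_n B_n)] of each [y]-step passes to the
    limit as [2 A_n(xs) B_n(xs) ys_n = 1].  On the feasible set
    [W(., ys) - H] is the sum of the squares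
    [ys_n (A_n - 1 / (2 ys_n B_n))^2], each of which then vanishes to second
    order at [xs].  So the derivative of [H] at [xs], like that of [W(., ys)],
    is nonnegative on the tangent cone, which is the linearized cone by
    Abadie's condition, and Farkas' lemma yields the multipliers. *)

Require Import Defs.
From HB Require Import structures.
From mathcomp Require Import all_boot all_order all_algebra.
From mathcomp Require Import all_classical all_reals all_analysis.
From mathcomp Require Import ring lra.

Set Implicit Arguments.
Unset Strict Implicit.
Unset Printing Implicit Defensive.

Import Order.TTheory GRing.Theory Num.Theory.
Import numFieldNormedType.Exports.

Local Open Scope classical_set_scope.
Local Open Scope ring_scope.

(** Induction on the constraints. If [a j] is redundant, its multiplier is 0. Otherwise some [w] has
    [0 < c w] and [a i w <= 0] on [s], which forces [0 < a j w]. Composing every functional with the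
    projection along [w] onto the kernel of [a j] removes that constraint, and the induction
    hypothesis applies to the composites. *)
Lemma farkas (R : realFieldType) (V : lmodType R) (I : eqType) (s : seq I)
    (a : I -> V -> R) (c : V -> R) :
  uniq s -> (forall i, scalar (a i)) -> scalar c ->
  (forall v, (forall i, i \in s -> a i v <= 0) -> c v <= 0) ->
  exists2 l : I -> R, forall i, 0 <= l i &
    forall v, c v = \sum_(i <- s) l i * a i v.
Proof.
elim: s a c => [|j s IHs] a c /=.
  move=> _ _ cL c_le0; exists (fun=> 0) => // v; rewrite big_nil.
  (* [scalar] speaks of [k *: u + v]; taking [k = -2] and [u = v] yields [- v] in one
     application. *)
  have cN : c (- v) = - c v.
    by have := cL (-2) v v; rewrite -[X in _ + X]scale1r -scalerDl
      [-2 + 1](_ : _ = -1) ?scaleN1r; [move=> ->; ring | ring].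
  apply/eqP; rewrite eq_le c_le0 //= -oppr_le0 -cN; exact: c_le0.
move=> /andP[js us] aL cL c_le0.
have [h|] := pselect (forall v, (forall i, i \in s -> a i v <= 0) -> c v <= 0).
  have [l l0 lE] := IHs a c us aL cL h.
  (* As [j] is not in [s], resetting its multiplier leaves the sum over [s] unchanged. *)
  exists (fun i => if i == j then 0 else l i) => [i|v]; first by case: ifP.
  rewrite big_cons eqxx mul0r add0r lE; apply: eq_big_seq => i si.
  by case: eqP => // ij; rewrite ij (negPf js) in si.
move=> /existsNP[w /not_implyP[aw /negP]]; rewrite -ltNge => cw.
have ajw : 0 < a j w.
  rewrite ltNge; apply/negP => ajw; move: cw; rewrite ltNge => /negP; apply.
  by apply: c_le0 => i; rewrite inE => /orP[/eqP -> //|]; exact: aw.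
(* [v + t v *: w] is the projection of [v] along [w] onto the kernel of
   [a j]. *)
pose t v := - (a j v / a j w).
have fE f v : scalar f -> f (t v *: w + v) = f v - f w / a j w * a j v.
  by move=> ->; rewrite /t; ring.
pose p f v : R := f (t v *: w + v).
have pL f : scalar f -> scalar (p f).
  by move=> fL k u v; rewrite /p !fE // fL aL; ring.
have [||u av|l l0 lE] := IHs (fun i => p (a i)) (p c) us.
- by move=> i; exact/pL.
- exact: pL.
- apply: c_le0 => i; rewrite inE => /orP[/eqP->|/av//].
  by rewrite (fE (a j))// divff ?gt_eqF// mul1r subrr.
(* The value forced by the required identity at [v = w]; it is nonnegative because [c w > 0] and
   each [a i w <= 0]. *)
pose m := (c w - \sum_(i <- s) l i * a i w) / a j w.
exists (fun i => if i == j then m else l i) => [i|v].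
  case: ifP => // _; rewrite divr_ge0 ?(ltW ajw)// subr_ge0.
  apply: le_trans (ltW cw); rewrite big_seq; apply: sumr_le0 => k sk.
  by rewrite mulr_ge0_le0 ?aw.
rewrite big_cons eqxx.
rewrite (eq_big_seq (fun i => l i * a i v)); last first.
  by move=> i si; case: eqP => // ij; rewrite ij (negPf js) in si.
have {lE} : c v - c w / a j w * a j v =
    \sum_(i <- s) (l i * a i v - l i * (a i w / a j w * a j v)).
  rewrite -(fE c v cL) [LHS](lE v); apply: eq_bigr => i _.
  by rewrite /p (fE (a i) v (aL i)) mulrBr.
move=> /eqP; rewrite subr_eq => /eqP ->.
rewrite big_split sumrN /= /m.
have -> : \sum_(i <- s) l i * (a i w / a j w * a j v) =
   (\sum_(i <- s) l i * a i w) / a j w * a j v.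
  by rewrite !mulr_suml; apply: eq_bigr => i _; ring.
ring.
Qed.

(** In the first-order expansion of [f] at [x], the linear part applied to the quotients [q k] tends
    to ['d f x d]. The remainder divided by [t k] is at most a small multiple of [|q k|], which is
    eventually bounded by [|d| + 1]. *)
Lemma tangent_derive_cvg (R : realType) (V : normedModType R) (f : V -> R)
    (x d : V) (z : nat -> V) (t : nat -> R) :
  differentiable f x -> z @ \oo --> x ->
  (fun k => (t k)^-1 *: (z k - x)) @ \oo --> d ->
  (fun k => (t k)^-1 * (f (z k) - f x)) @ \oo --> 'D_d f x.
Proof.
move=> df zx zd; rewrite deriveE //.
have h0 : z k - x @[k --> \oo] --> 0.
  by rewrite -(subrr x); apply: cvgB zx (cvg_cst _).
set q := fun k => (t k)^-1 *: (z k - x).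
have dq : ('d f x (q k)) @[k --> \oo] --> 'd f x d.
  by apply: (continuous_cvg _ _ zd); exact: diff_continuous.
pose o : V -> R := [o_ 0 id of f \o shift x - (cst (f x) + 'd f x)].
have fE h : f (h + x) = f x + 'd f x h + o h.
  by have := congr1 (@^~ h) (diff_locally df).
rewrite (_ : (fun k => _) =
  fun k => 'd f x (q k) + (t k)^-1 * o (z k - x)); last first.
  apply/funext => k; rewrite -{1}(subrK x (z k)) fE linearZ /=.
  by rewrite -[_ *: 'd f x _]/(_ * _); ring.
rewrite -[X in _ --> X]addr0; apply: cvgD dq _.
apply/cvgr0Pnorm_le => e e0.
have c0 : 0 < `|d| + 1 by rewrite ltr_wpDl.
have ec0 : 0 < e / (`|d| + 1) by rewrite divr_gt0.
have qb : \forall k \near \oo, `|q k| <= `|d| + 1.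
  have /cvgrPdist_le /(_ 1 ltr01) := zd.
  apply: filterS => k; rewrite distrC => dk; rewrite -[q k](subrK d) addrC.
  by apply: le_trans (ler_normD _ _) _; rewrite lerD2l.
have ob : \forall k \near \oo,
    `|o (z k - x)| <= e / (`|d| + 1) * `|z k - x|.
  exact: h0 (littleoP [littleo of o] ec0).
apply: filterS2 qb ob => k qk ok; rewrite normrM.
apply: le_trans (ler_wpM2l (normr_ge0 _) ok) _.
rewrite mulrCA -normrZ -/(q k).
apply: le_trans (ler_wpM2l (ltW ec0) qk) _.
by rewrite divfK ?gt_eqF.
Qed.

Lemma balanced_of_minimizer (R : realFieldType) (a b s : R) :
  0 <= a -> 0 < b -> 0 < s ->
  (forall t, 0 < t ->
    a ^+ 2 * s + 1 / (4 * b ^+ 2 * s) <= a ^+ 2 * t + 1 / (4 * b ^+ 2 * t)) ->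
  2 * a * b * s = 1.
Proof.
move=> a0 b0 s0 smin.
have bn0 := lt0r_neq0 b0; have sn0 := lt0r_neq0 s0.
(* If [a = 0], only the term in [1 / t] remains and doubling [s] halves it, so [s] cannot be a
   minimizer. *)
have [aE|an0] := eqVneq a 0.
  have := smin (2 * s); rewrite aE mulr_gt0// => /(_ isT).
  have -> : 1 / (4 * b ^+ 2 * (2 * s)) = 1 / (4 * b ^+ 2 * s) / 2.
    by field; rewrite bn0 sn0.
  have : 0 < 1 / (4 * b ^+ 2 * s) by rewrite divr_gt0 ?mulr_gt0 ?exprn_gt0.
  by rewrite expr0n /= !mul0r !add0r; lra.
(* The critical point is the competitor: its value falls short of that at [s] by a square over a
   positive number, so the square vanishes. *)
have t0 : 0 < (2 * a * b)^-1 by rewrite invr_gt0 !mulr_gt0 // lt0r an0.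
have := smin _ t0; rewrite -subr_ge0.
have -> : a ^+ 2 / (2 * a * b) + 1 / (4 * b ^+ 2 * (2 * a * b)^-1) -
    (a ^+ 2 * s + 1 / (4 * b ^+ 2 * s)) =
    - ((2 * a * b * s - 1) ^+ 2 / (4 * b ^+ 2 * s)).
  by field; rewrite an0 bn0 sn0.
rewrite oppr_ge0 pmulr_lle0 ?invr_gt0 ?mulr_gt0 ?exprn_gt0// => le0.
have /eqP : (2 * a * b * s - 1) ^+ 2 = 0.
  by apply/eqP; rewrite eq_le le0 sqr_ge0.
by rewrite sqrf_eq0 subr_eq0 => /eqP.
Qed.

Lemma cvg_Wobj (R : realType) (M N : nat) (G : 'rV[R]_M -> R)
    (A B : 'I_N -> 'rV[R]_M -> R) (x : nat -> 'rV[R]_M) (y : nat -> 'rV[R]_N)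
    (xs : 'rV[R]_M) (ys : 'rV[R]_N) :
  {for xs, continuous G} -> (forall n, {for xs, continuous (A n)}) ->
  (forall n, {for xs, continuous (B n)}) ->
  (forall n, B n xs != 0) -> (forall n, ys 0 n != 0) ->
  x @ \oo --> xs -> y @ \oo --> ys ->
  (fun k => Wobj G A B (x k) (y k)) @ \oo --> Wobj G A B xs ys.
Proof.
move=> Gc Ac Bc B0 y0 xxs yys; rewrite /Wobj.
have cx (f : 'rV[R]_M -> R) :
    {for xs, continuous f} -> f (x k) @[k --> \oo] --> f xs.
  by move=> fc; apply: (continuous_cvg _ _ xxs).
apply: cvgD; first exact: cx.
apply: cvg_big => [|n _]; first exact: add_continuous.
have yc : y k 0 n @[k --> \oo] --> ys 0 n.
  by apply: (@continuous_cvg _ _ _ _ _ y (fun z : 'rV[R]_N => z 0 n) ys _ yys);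
    exact: coord_continuous.
apply: cvgD.
  by apply: cvgM => //; apply: cvgM; apply: cx.
apply: cvgM; first exact: cvg_cst.
apply: cvgV; first by rewrite !mulf_neq0.
apply: cvgM => //; apply: cvgM; first exact: cvg_cst.
by apply: cvgM; apply: cx.
Qed.

Lemma derive_scalar (R : realType) (V : normedModType R) (f : V -> R) (x : V) :
  differentiable f x -> scalar (fun d => 'D_d f x).
Proof. by move=> df k u v; rewrite !deriveE // linearP. Qed.

(** The derivative is the limit of the quotients along a feasible sequence tangent to [d], each
    nonnegative by minimality. *)
Lemma minimizer_derive_ge0 (R : realType) (M : nat) (S : set 'rV[R]_M)
    (f : 'rV[R]_M -> R) (x d : 'rV[R]_M) :
  is_minimizer f S x -> differentiable f x -> tangent_cone S x d ->
  0 <= 'D_d f x.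
Proof.
move=> [_ xmin] df [z [t [Sz t0 zx _ zd]]].
move/cvgr_to_ge: (tangent_derive_cvg df zx zd); apply.
apply: nearW => k; rewrite mulr_ge0 ?invr_ge0 ?(ltW (t0 k))// subr_ge0.
exact/xmin/Sz.
Qed.

Lemma kkt_of_derive_ge0 (R : realType) (M nQ nR : nat) (f : 'rV[R]_M -> R)
    (Qc : 'I_nQ -> 'rV[R]_M -> R) (Rc : 'I_nR -> 'rV[R]_M -> R)
    (x : 'rV[R]_M) :
  differentiable f x -> (forall q, differentiable (Qc q) x) ->
  (forall r, differentiable (Rc r) x) -> feasible_set Qc Rc x ->
  (forall d, linearized_cone Qc Rc x d -> 0 <= 'D_d f x) ->
  kkt_point f Qc Rc x.
Proof.
move=> df dQ dR Sx f_ge0.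
(* Each equality enters as two opposite inequalities, so its free multiplier [beta] is a difference
   of two nonnegative ones. *)
pose I := ('I_nQ + ('I_nR + 'I_nR))%type.
pose a (i : I) (d : 'rV[R]_M) : R := match i with
  | inl q => 'D_d (Qc q) x
  | inr (inl r) => 'D_d (Rc r) x
  | inr (inr r) => - 'D_d (Rc r) x
  end.
pose act (i : I) := if i is inl q then Qc q x == 0 else true.
have [||||l l0 lE] := @farkas R 'rV[R]_M I [seq i <- index_enum I | act i] a
  (fun d => - 'D_d f x).
- exact/filter_uniq/index_enum_uniq.
- move=> [q|[r|r]] k u v /=; rewrite derive_scalar //.
  by rewrite opprD mulrN.
- by move=> k u v; rewrite derive_scalar // opprD mulrN.
- move=> d ad; rewrite oppr_le0; apply: f_ge0; split => [q Q0|r].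
    by apply: (ad (inl q)); rewrite mem_filter /= Q0 eqxx mem_index_enum.
  apply/eqP; rewrite eq_le -[X in _ && X]oppr_le0.
  by rewrite (ad (inr (inl r))) ?(ad (inr (inr r))) ?mem_filter ?mem_index_enum.
(* Only active constraints were given to Farkas' lemma; 0 elsewhere yields complementary
   slackness. *)
pose alpha q := if Qc q x == 0 then l (inl q) else 0.
pose beta r := l (inr (inl r)) - l (inr (inr r)).
exists alpha, beta; split => // [m|q|q]; last 2 first.
- by rewrite /alpha; case: ifP.
- by rewrite /alpha; case: eqP => [->|_]; rewrite ?mulr0 ?mul0r.
(* As a combination of functions, the Lagrangian has its derivative computed by the [is_derive]
   instances. *)
rewrite (_ : (fun z => _) = f + \sum_(q < nQ) alpha q *: Qc q +
    \sum_(r < nR) beta r *: Rc r); last by rewrite !fct_sumE.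
set e := basis_vec R m.
have dd (g : 'rV[R]_M -> R) : differentiable g x -> is_derive x e g ('D_e g x).
  by move=> dg; apply/derivableP/diff_derivable.
have df' := dd _ df; have dQ' q := dd _ (dQ q); have dR' r := dd _ (dR r).
apply: is_derive_eq; have := lE e.
rewrite big_filter big_sumType /= big_sumType /=.
rewrite -big_split /= big_mkcond => fE.
apply/eqP; rewrite -addrA addrC -(opprK ('D_e f x)) subr_eq0 fE; apply/eqP.
congr (_ + _); apply: eq_bigr => i _.
  by rewrite /alpha; case: ifP => // _; rewrite scale0r.
by rewrite /beta /= scalerBl mulrN.
Qed.

(** [Wobj] is separable in [y]: when only the coordinate [n] varies, all other terms cancel, leaving
    a one-variable minimization. *)
Lemma minimizer_Wobj_coord (R : realType) (M N : nat) (G : 'rV[R]_M -> R)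
    (A B : 'I_N -> 'rV[R]_M -> R) (x : 'rV[R]_M) (y : 'rV[R]_N) (n : 'I_N) :
  0 <= A n x -> 0 < B n x ->
  is_minimizer (Wobj G A B x) (@positive_orthant R N) y ->
  2 * A n x * B n x * y 0 n = 1.
Proof.
move=> A0 B0 [y0 ymin]; apply: balanced_of_minimizer => // t t0.
pose v := \row_m (if m == n then t else y 0 m).
have /ymin : @positive_orthant R N v.
  by move=> m; rewrite mxE; case: ifP => // _; exact: y0.
rewrite lerD2l (bigD1 n) //= [leRHS](bigD1 n) //= mxE eqxx.
rewrite [X in _ <= _ + X](eq_bigr (fun m => A m x ^+ 2 * y 0 m +
  1 / (4 * B m x ^+ 2 * y 0 m))); first by rewrite lerD2r.
by move=> m mn; rewrite mxE (negPf mn).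
Qed.

Lemma alternating_minimizer_limit (R : realType) (M N : nat)
    (W : 'rV[R]_M -> 'rV[R]_N -> R) (S : set 'rV[R]_M) (Y : set 'rV[R]_N)
    (x : nat -> 'rV[R]_M) (y : nat -> 'rV[R]_N)
    (xs : 'rV[R]_M) (ys : 'rV[R]_N) :
  alternating_process W S Y x y -> S xs ->
  (fun k => W (x k) (y k)) @ \oo --> W xs ys ->
  (forall u, S u -> W u (y k) @[k --> \oo] --> W u ys) ->
  is_minimizer (fun u => W u ys) S xs.
Proof.
move=> [_ proc] Sxs Wc Wuc; split => // u Su.
(* The [x]-step compares values at [x k.+1] and [y k.+1], and says nothing at index 0; hence the
   shifts. *)
have := Wc; rewrite -cvg_shiftS => Wc1.
have := Wuc u Su; rewrite -cvg_shiftS => Wuc1.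
apply: (ler_cvg_to Wc1 Wuc1); apply: nearW => k /=.
by have [_ [_]] := proc k; apply.
Qed.

(** Completing the square: twice the product of the two square roots in a term is
    [A n x / B n x]. *)
Lemma Wobj_square (R : realType) (M N : nat) (G : 'rV[R]_M -> R)
    (A B : 'I_N -> 'rV[R]_M -> R) (x : 'rV[R]_M) (y : 'rV[R]_N) :
  (forall n, B n x != 0) -> (forall n, y 0 n != 0) ->
  Wobj G A B x y = Hobj G A B x +
    \sum_(n < N) y 0 n * (A n x - (2 * y 0 n)^-1 * (B n x)^-1) ^+ 2.
Proof.
move=> B0 y0; rewrite /Wobj /Hobj -addrA -big_split /=; congr (_ + _).
by apply: eq_bigr => n _; field; rewrite B0 y0.
Qed.

Theorem mainTheorem1 (R : realType) (M N nQ nR : nat)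
    (Qc : 'I_nQ -> 'rV[R]_M -> R) (Rc : 'I_nR -> 'rV[R]_M -> R)
    (U : set 'rV[R]_M)
    (G : 'rV[R]_M -> R) (A B : 'I_N -> 'rV[R]_M -> R)
    (hQ : forall q, C1_on setT (Qc q))
    (hR : forall r, C1_on setT (Rc r))
    (hconv : convex_set (feasible_set Qc Rc))
    (hSU : feasible_set Qc Rc `<=` U)
    (hG : C1_on U G)
    (hA : forall n, C1_on U (A n))
    (hB : forall n, C1_on U (B n))
    (hAconvex : forall n, convex_function (feasible_set Qc Rc) (A n))
    (hA_ge0 : forall n x, feasible_set Qc Rc x -> 0 <= A n x)
    (hBconcave : forall n, concave_function (feasible_set Qc Rc) (B n))
    (hB_gt0 : forall n x, feasible_set Qc Rc x -> 0 < B n x)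
    (x : nat -> 'rV[R]_M) (y : nat -> 'rV[R]_N)
    (hproc : alternating_process (Wobj G A B) (feasible_set Qc Rc)
               (@positive_orthant R N) x y)
    (xs : 'rV[R]_M) (ys : 'rV[R]_N)
    (hxs : feasible_set Qc Rc xs) (hys : @positive_orthant R N ys)
    (hx_cvg : x @ \oo --> xs) (hy_cvg : y @ \oo --> ys)
    (hcq : abadie_cq Qc Rc xs) :
  kkt_point (Hobj G A B) Qc Rc xs.
Proof.
set S := feasible_set Qc Rc.
have dx f : C1_on U f -> differentiable f xs.
  by move=> [_ /(_ xs (hSU _ hxs))[]].
have dU f u : C1_on U f -> S u -> {for u, continuous f}.
  move=> [_ Uf] Su; apply: differentiable_continuous.
  by have [] := Uf u (hSU _ Su).
have B0 n u : S u -> B n u != 0 by move=> Su; rewrite gt_eqF ?hB_gt0.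
have ys0 n : ys 0 n != 0 by rewrite gt_eqF ?hys.
have [x0 proc] := hproc.
have Sx k : S (x k).
  by case: k => [//|k]; have [_ []] := proc k.
have Wmin : is_minimizer (fun u => Wobj G A B u ys) S xs.
  apply: (alternating_minimizer_limit hproc hxs).
    by apply: cvg_Wobj => // [|n|n|n]; rewrite ?B0 //; exact: dU.
  move=> u Su; apply: (cvg_Wobj (x := fun=> u)) => // [|n|n|n|].
  - exact: dU.
  - exact: dU.
  - exact: dU.
  - exact: B0.
  - exact: cvg_cst.
have balanced n : 2 * A n xs * B n xs * ys 0 n = 1.
  have cx (f : 'rV[R]_M -> R) : C1_on U f -> f (x k) @[k --> \oo] --> f xs.
    by move=> fU; apply: (continuous_cvg _ _ hx_cvg); exact: dU.
  (* The [y]-step ties [y k.+1] to [x k], so only [y] is shifted. *)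
  have yc : y k.+1 0 n @[k --> \oo] --> ys 0 n.
    have := hy_cvg; rewrite -cvg_shiftS => yc.
    by apply: (@continuous_cvg _ _ _ _ _ _ (fun z : 'rV[R]_N => z 0 n) ys _ yc);
      exact: coord_continuous.
  have c : 2 * A n (x k) * B n (x k) * y k.+1 0 n @[k --> \oo]
      --> 2 * A n xs * B n xs * ys 0 n.
    apply: cvgM => //; apply: cvgM; last exact: cx.
    by apply: cvgM; [exact: cvg_cst | exact: cx].
  suff c1 : 2 * A n (x k) * B n (x k) * y k.+1 0 n @[k --> \oo] --> (1 : R).
    exact: (cvg_unique _ c c1).
  apply: cvg_near_cst; apply: nearW => k.
  have [ymin _] := proc k.
  exact: (minimizer_Wobj_coord (hA_ge0 n _ (Sx k)) (hB_gt0 n _ (Sx k)) ymin).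
pose u n : 'rV[R]_M -> R := A n - (2 * ys 0 n)^-1 *: (fun z => (B n z)^-1).
have du n : differentiable (u n) xs.
  apply: differentiableB; first exact: dx.
  by apply: differentiableZ; apply: differentiableV; [exact: dx | exact: B0].
have u0 n : u n xs = 0.
  have b0 := B0 n _ hxs; rewrite -[LHS]/(A n xs - (2 * ys 0 n)^-1 * (B n xs)^-1).
  have -> : A n xs = (2 * ys 0 n)^-1 * (B n xs)^-1; last by rewrite subrr.
  (* Replacing a factor 1 by the product in [balanced] leaves a field identity. *)
  by rewrite -[RHS]mul1r -[X in X * _](balanced n); field; rewrite b0 ys0.
have dH : differentiable (Hobj G A B) xs.
  rewrite (_ : Hobj G A B = G + \sum_(n < N) A n * (fun z => (B n z)^-1)).
    apply: differentiableD; first exact: dx.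
    apply: differentiable_sum => n; apply: differentiableM; first exact: dx.
    by apply: differentiableV; [exact: dx | exact: B0].
  by rewrite fct_sumE.
(* On [S] this is [Wobj] at [ys], so it inherits the minimizer [xs]; this form exposes its
   difference from [Hobj] as squares. *)
pose F := Hobj G A B + \sum_(n < N) ys 0 n *: (u n) ^+ 2.
have dF : differentiable F xs.
  apply: differentiableD => //; apply: differentiable_sum => n.
  by apply: differentiableZ; apply: differentiableX.
have Fmin : is_minimizer F S xs.
  have FE z : S z -> F z = Wobj G A B z ys.
    by move=> Sz; rewrite /F !fctE fct_sumE Wobj_square // => n; exact: B0.
  by split=> // z Sz; rewrite !FE //; apply: Wmin.2.
apply: kkt_of_derive_ge0 => // [q|r|d].
- by have [_ /(_ xs I)[]] := hQ q.
- by have [_ /(_ xs I)[]] := hR r.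
rewrite -hcq => /(minimizer_derive_ge0 Fmin dF).
suff -> : 'D_d F xs = 'D_d (Hobj G A B) xs by [].
have dH' := derivableP (diff_derivable (v := d) dH).
have du' n := derivableP (diff_derivable (v := d) (du n)).
(* The derivative of each square carries the factor [u n xs], which is 0. *)
rewrite derive_val big1 ?addr0 // => n _.
by rewrite u0 expr1 mulr0 scale0r scaler0.
Qed.
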